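(* There exist universal constants $c,C>0$ such that the following holds. Let $n=2m-1$ be odd, $\mu\in\mathbb R$, and $X_1,\dots,X_n$ i.i.d. $\mathcal N(\mu,1)$. Fix $\eta\in(0,1/3)$ and let $k=\lfloor\eta n\rfloor$. Then for every $\beta\in(0,1/2)$, with probability at least $1-\beta-Ce^{-cn}$, \[S^{\mathrm{med}}_\eta(X)\le C\left(\eta+\frac{\log(1/\beta)}{n}\right).\]
   Context: For $x\in\mathbb R^n$ with order statistics $x_{(1)}\le\dots\le x_{(n)}$, $\mathrm{med}(x)=x_{(m)}$. $d_H(x,y)=\#\{i: x_i\ne y_i\}$, and $S^{\mathrm{med}}_\eta(x)=\sup_{y\in\mathbb R^n\colon d_H(x,y)\le k}|\mathrm{med}(x)-\mathrm{med}(y)|$ with $k=\lfloor\eta n\rfloor$. *)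

(* Defs.v *)
From HB Require Import structures.
From mathcomp Require Import all_boot all_order all_algebra.
From mathcomp Require Import all_classical all_reals all_analysis.
From mathcomp Require Import Rstruct Rstruct_topology.
Set Implicit Arguments. Unset Strict Implicit. Unset Printing Implicit Defensive.
Import Order.TTheory GRing.Theory Num.Theory.
Local Open Scope classical_set_scope.
Local Open Scope ring_scope.

Notation R := (Rdefinitions.R : realType).

Notation nodd m := ((2 * m).-1)%N.

Definition order_stats (n : nat) (x : 'I_n -> R) : seq R :=
  sort <=%R [seq x i | i <- enum 'I_n].

(* med(x) = x_(m) (the m-th smallest, i.e. index m-1 from 0). *)
Definition med (m : nat) (x : 'I_(nodd m) -> R) : R :=
  nth 0 (order_stats x) m.-1.

Definition dH (n : nat) (x y : 'I_n -> R) : nat := #|[set i | x i != y i]|.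

Definition kk (n : nat) (eta : R) : int := Num.floor (eta * n%:R).

Definition Smed (m : nat) (eta : R) (x : 'I_(nodd m) -> R) : \bar R :=
  ereal_sup [set (`|med x - med y|)%:E | y in [set y | ((dH x y)%:Z <= kk (nodd m) eta)%R]].

(* Mutual independence of a finite family of real random variables:
   for every family of Borel sets B_i, P(/\_i {X_i in B_i}) = prod_i P(X_i in B_i).
   (Taking B_i = setT recovers the product rule for every subfamily.) *)
Definition mutually_independent d (T : measurableType d) (P : probability T R)
    (n : nat) (X : 'I_n -> {RV P >-> R}) : Prop :=
  forall B : 'I_n -> set R, (forall i, measurable (B i)) ->
    P (\bigcap_i (X i @^-1` B i)) = (\prod_(i < n) P (X i @^-1` B i))%E.

Definition has_normal_law d (T : measurableType d) (P : probability T R)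
    (Y : {RV P >-> R}) (mu sigma : R) : Prop :=
  forall A : set R, measurable A -> distribution P Y A = normal_prob mu sigma A.

(* Main.v *)
Require Import Defs.
From HB Require Import structures.
From mathcomp Require Import all_boot all_order all_algebra.
From mathcomp Require Import all_classical all_reals all_analysis.
From mathcomp Require Import Rstruct Rstruct_topology.
From mathcomp Require Import measurable_realfun.
From mathcomp Require Import zify ring lra.
Import Order.TTheory GRing.Theory Num.Theory.
Local Open Scope classical_set_scope.
Local Open Scope ring_scope.

(** S^med <= t holds exactly when at least m + k sample points lie below
    med + t and, symmetrically, at least m + k lie above med - t.  Suppose the
    first condition fails, and cut the line around mu into cells of length t/2.
    If the median lies in (v_l, v_(l+1)], then at most k points lie in
    (v_(l+1), v_(l+2)], although at least m - k >= n/6 points lie above v_(l+1).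
    Given which points lie above v_(l+1), the number of points in
    (v_(l+1), v_(l+2)] dominates a binomial variable with success probability of
    order t, so this has conditional probability at most 2^k exp(- c t n).  The
    events locating the median in one of the cells are disjoint, so the sum over
    l costs no factor.  The median stays within distance 10 of mu outside an event
    of probability 2 exp(- n).  For t = C (eta + log(1/beta) / n) the remaining
    term is at most beta^2.

    For a fixed cell only finitely many events per coordinate matter, so the
    conditioning is carried out on finite sums of products of cell
    probabilities. *)

(** * Sums of products over finite functions *)

(** Group the functions [f] by their image [g] under [h]. Once [g] is fixed, the coordinates of [f]
    vary independently, so the inner sum factorises by distributivity. *)
Lemma sum_prod_fibers (F : comNzRingType) (I J K : finType) (h : J -> K)
    (w : I -> J -> F) (Q : pred {ffun I -> K}) :
  \sum_(f : {ffun I -> J} | Q [ffun i => h (f i)]) \prod_i w i (f i) =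
  \sum_(g | Q g) \prod_i \sum_(j | h j == g i) w i j.
Proof.
rewrite (partition_big (fun f : {ffun I -> J} => [ffun i => h (f i)]) Q) //=.
apply: eq_bigr => g Qg; rewrite (bigA_distr_big_dep (fun i j => h j == g i)).
apply: eq_bigl => f; apply/andP/familyP => [[_ /eqP <-] i|fg].
  by rewrite -topredE /= ffunE.
suff -> : [ffun i => h (f i)] = g by [].
by apply/ffunP => i; rewrite ffunE; apply/eqP; have := fg i; rewrite -topredE.
Qed.

Lemma prod_if_expr (F : comNzRingType) (I : finType) (a : pred I) (x : F) :
  \prod_i (if a i then x else 1) = x ^+ #|[pred i | a i]|.
Proof.
by rewrite -big_mkcond /= -prodr_const; apply: eq_bigl => i.
Qed.

Section WeightedSums.
Context {F : realFieldType} {I J : finType} (p : I -> J -> F).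
Hypothesis p_ge0 : forall i j, 0 <= p i j.

(** Markov's inequality for [x ^+ #a]: on the event this weight is at least [x ^+ r], and its total
    over all [f] is a product of one-coordinate sums. *)
Lemma sum_prod_card_ge (a : pred J) (r : nat) (x y : F) : 1 <= x ->
  (forall i, \sum_j (if a j then x else 1) * p i j <= y) ->
  x ^+ r * \sum_(f : {ffun I -> J} | (r <= #|[pred i | a (f i)]|)%N)
    \prod_i p i (f i) <= y ^+ #|I|.
Proof.
move=> x1 hy.
have x0 : 0 <= x by exact: le_trans ler01 x1.
have w0 i j : 0 <= (if a j then x else 1) * p i j.
  by rewrite mulr_ge0 //; case: ifP.
pose w (f : {ffun I -> J}) := \prod_i ((if a (f i) then x else 1) * p i (f i)).
have w_ge0 f : 0 <= w f by exact: prodr_ge0.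
apply: (@le_trans _ _ (\sum_f w f)); last first.
  rewrite /w -(bigA_distr_bigA (fun i j => (if a j then x else 1) * p i j)).
  rewrite -prodr_const; apply: ler_prod => i _; rewrite hy andbT.
  exact: sumr_ge0.
rewrite mulr_sumr big_mkcond /=; apply: ler_sum => f _.
case: ifP => // rf; rewrite /w big_split /= (prod_if_expr _ _ (fun i => a (f i))).
by rewrite ler_wpM2r ?prodr_ge0 // ler_weXn2l.
Qed.

(* Chernoff's bound with weight 1/2: the indicator of #a <= k is at most
   2 ^ (k - #a), and summing 2 ^ - #a over the fibers of h costs a factor rho
   for each coordinate in a fiber satisfying b. *)
Lemma sum_prod_card_le {K : finType} (h : J -> K) (a : pred J) (b : pred K)
    (Q : pred {ffun I -> K}) (s k : nat) (rho : F) : 0 <= rho <= 1 ->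
  (forall i l, b l -> \sum_(j | h j == l) (if a j then 2^-1 else 1) * p i j
                      <= rho * \sum_(j | h j == l) p i j) ->
  \sum_(f : {ffun I -> J} | [&& Q [ffun i => h (f i)],
        (s <= #|[pred i | b (h (f i))]|)%N & (#|[pred i | a (f i)]| <= k)%N])
      \prod_i p i (f i)
    <= 2 ^+ k * rho ^+ s *
       \sum_(f : {ffun I -> J} | Q [ffun i => h (f i)]) \prod_i p i (f i).
Proof.
move=> /andP[rho0 rho1] hrho.
pose w i j := (if a j then 2^-1 else 1) * p i j.
have w0 i j : 0 <= w i j.
  by rewrite mulr_ge0 //; case: ifP; rewrite // invr_ge0.
pose Q' (g : {ffun I -> K}) := Q g && (s <= #|[pred i | b (g i)]|)%N.
apply: (@le_trans _ _ (2 ^+ k *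
  \sum_(f : {ffun I -> J} | Q' [ffun i => h (f i)]) \prod_i w i (f i))).
  rewrite mulr_sumr big_mkcond [leRHS]big_mkcond /=; apply: ler_sum => f _.
  have -> : Q' [ffun i => h (f i)] =
      Q [ffun i => h (f i)] && (s <= #|[pred i | b (h (f i))]|)%N.
    rewrite /Q'; congr (_ && (_ <= _)%N).
    by apply: eq_card => i; rewrite !inE ffunE.
  rewrite andbA; have [_|_] := boolP (Q _ && (s <= _)%N) => //=.
  have ge0 : 0 <= 2 ^+ k * \prod_i w i (f i).
    by rewrite mulr_ge0 ?exprn_ge0 ?prodr_ge0.
  case: ifP => // ak; rewrite /w big_split /=.
  rewrite (prod_if_expr _ _ (fun i => a (f i))) mulrA ler_peMl ?prodr_ge0 //.
  by rewrite exprVn -ler_pdivrMr ?invr_gt0 ?exprn_gt0 // mul1r invrK ler_weXn2l //; lra.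
(* Regrouping both sides by the image [g] plays the role of conditioning on [g]: the comparison
   becomes a product of one-coordinate comparisons. *)
rewrite -mulrA ler_wpM2l ?exprn_ge0 // (sum_prod_fibers _ _ _ _ h w Q').
rewrite (sum_prod_fibers _ _ _ _ h p Q) mulr_sumr.
rewrite big_mkcond [leRHS]big_mkcond /=; apply: ler_sum => g _.
rewrite /Q'; case: (Q g) => //=.
have P0 : 0 <= \prod_i \sum_(j | h j == g i) p i j.
  by apply: prodr_ge0 => i _; exact: sumr_ge0.
case: ifP => [sg|_]; last by rewrite mulr_ge0 ?exprn_ge0.
apply: (@le_trans _ _ (rho ^+ #|[pred i | b (g i)]| *
    \prod_i \sum_(j | h j == g i) p i j)); last first.
  by rewrite ler_wpM2r // ler_wiXn2l.
rewrite -(prod_if_expr _ _ (fun i => b (g i))) -big_split /=.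
apply: ler_prod => i _; rewrite sumr_ge0 //=.
case: ifP => [bg|_]; first exact: hrho.
rewrite mul1r; apply: ler_sum => j _; rewrite ler_piMl //.
by case: ifP => // _; rewrite invf_le1 //; lra.
Qed.

End WeightedSums.

(** * Independent coordinates *)

Section FiniteValued.
Context {d : measure_display} {T : measurableType d} {J : finType}.
Context (Y : T -> J) (mY : forall j, measurable [set w | Y w = j]).

Lemma preimage_pred_bigcup (F : pred J) :
  [set w | F (Y w)] = \bigcup_(j in [set` enum F]) [set w | Y w = j].
Proof.
apply/seteqP; split => [w /= Fw|w /= [j /=]].
  by exists (Y w) => //=; rewrite mem_enum.
by rewrite mem_enum => Fj ->.
Qed.

Lemma measurable_finite_pred (F : pred J) : measurable [set w | F (Y w)].
Proof.
rewrite preimage_pred_bigcup; apply: fin_bigcup_measurable => //.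
Qed.

Lemma prob_finite_pred (P : probability T R) (F : pred J) :
  P [set w | F (Y w)] = (\sum_(j | F j) P [set w | Y w = j])%E.
Proof.
rewrite preimage_pred_bigcup measure_fin_bigcup //.
- by rewrite -fsbig_seq ?enum_uniq //= big_enum.
- by move=> i j _ _ [w [/= <- <-]].
Qed.

End FiniteValued.

Section FiniteVector.
Context {d : measure_display} {T : measurableType d} {I J : finType}.
Context (Y : I -> T -> J) (mY : forall i j, measurable [set w | Y i w = j]).

Lemma ffun_fiber (f : {ffun I -> J}) :
  [set w | [ffun i => Y i w] = f] = \bigcap_i [set w | Y i w = f i].
Proof.
apply/seteqP; split => [w /= <- i _ /=|w /= h]; first by rewrite ffunE.
by apply/ffunP => i; rewrite ffunE; exact: h.
Qed.

Lemma measurable_ffun_fiber (f : {ffun I -> J}) :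
  measurable [set w | [ffun i => Y i w] = f].
Proof. by rewrite ffun_fiber; exact: fin_bigcap_measurable. Qed.

Lemma measurable_ffun_pred (F : pred {ffun I -> J}) :
  measurable [set w | F [ffun i => Y i w]].
Proof. exact: (measurable_finite_pred _ measurable_ffun_fiber). Qed.

End FiniteVector.

Section Independent.
Context {d : measure_display} {T : measurableType d} (P : probability T R).
Context {n : nat} (X : 'I_n -> T -> R).
Hypothesis mX : forall i, measurable_fun setT (X i).
Hypothesis indX : forall B : 'I_n -> set R, (forall i, measurable (B i)) ->
  P (\bigcap_i (X i @^-1` B i)) = (\prod_(i < n) P (X i @^-1` B i))%E.

Lemma measurable_preimage_pred (i : 'I_n) (A : set R) :
  measurable A -> measurable (X i @^-1` A).
Proof. by move=> mA; rewrite -[_ @^-1` _]setTI; exact: mX. Qed.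

Lemma prob_cells {J : finType} (cell : R -> J)
    (mcell : forall j, measurable [set x | cell x = j])
    (F : pred {ffun 'I_n -> J}) :
  P [set w | F [ffun i => cell (X i w)]] =
  (\sum_(f | F f) \prod_i fine (P (X i @^-1` [set x | cell x = f i])))%:E.
Proof.
have mc i j : measurable [set w | cell (X i w) = j].
  exact: (measurable_preimage_pred i [set x | cell x = j]).
rewrite (prob_finite_pred _ (measurable_ffun_fiber _ mc)) -sumEFin.
apply: eq_bigr => f _; rewrite ffun_fiber.
rewrite (indX (fun i => [set x | cell x = f i])) // -prodEFin.
by apply: eq_bigr => i _; rewrite fineK // fin_num_measure //; exact: mc.
Qed.

(** Chernoff's upper tail: a coordinate contributes at most 1 to the weighted sum from the points
    where [a] fails and at most [e * x] from those where it holds. *)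
Lemma prob_card_ge (a : R -> bool) (r : nat) (e x : R) :
  measurable [set y | a y] -> 1 <= x ->
  (forall i, (P (X i @^-1` [set y | a y]) <= e%:E)%E) ->
  ((x ^+ r)%:E * P [set w | (r <= #|[pred i | a (X i w)]|)%N] <=
   ((1 + e * x) ^+ n)%:E)%E.
Proof.
move=> ma x1 hP.
have mcell j : measurable [set y | a y = j].
  case: j => //; suff -> : [set y | a y = false] = ~` [set y | a y].
    exact: measurableC.
  by apply/seteqP; split => y /= => [->|/negP/negbTE].
pose F (g : {ffun 'I_n -> bool}) := (r <= #|[pred i | g i]|)%N.
have -> : [set w | (r <= #|[pred i | a (X i w)]|)%N] =
    [set w | F [ffun i => a (X i w)]].
  apply/seteqP; split => w /=; congr (is_true (_ <= _)%N);
  by apply: eq_card => i; rewrite !inE ffunE.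
rewrite (prob_cells a mcell F) -EFinM lee_fin.
pose p i j := fine (P (X i @^-1` [set y | a y = j])).
have p0 i j : 0 <= p i j by exact: fine_ge0.
have := sum_prod_card_ge p p0 id r x (1 + e * x) x1.
rewrite card_ord; apply => i.
rewrite big_bool /= mul1r addrC lerD //.
  rewrite /p -[leRHS]/(fine 1%E) fine_le ?fin_num_measure ?probability_le1 //;
  exact: measurable_preimage_pred.
rewrite mulrC ler_wpM2r //; first exact: le_trans x1.
rewrite /p -[leRHS]/(fine e%:E) fine_le //.
by rewrite fin_num_measure //; exact: measurable_preimage_pred.
Qed.

(** The event that locates the median depends only on the position of each point relative to [u] and
    [v]. Given these positions, a point above [v] still falls in [(v, z]] with probability at least
    [q], which yields a factor [expR (- (q / 2))] for each such point. *)
Lemma prob_card_itv_le (u v z q : R) (m s k : nat) : u <= v -> 0 <= q ->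
  (forall i, (q%:E <= P (X i @^-1` [set x | v < x <= z])%R)%E) ->
  (P [set w | [&& (#|[pred i | (X i w <= u)%R]| < m <= #|[pred i | (X i w <= v)%R]|)%N,
                  (s <= #|[pred i | (v < X i w)%R]|)%N &
                  (#|[pred i | (v < X i w <= z)%R]| <= k)%N]] <=
   (2 ^+ k * expR (- (q / 2)) ^+ s)%:E *
   P [set w | (#|[pred i | (X i w <= u)%R]| < m <= #|[pred i | (X i w <= v)%R]|)%N])%E.
Proof.
move=> uv q0 hq.
(* [Some true], [Some false] and [None] encode [x <= u], [u < x <= v] and [v < x]. The second
   component of [cell] is the finer information that is averaged out. *)
pose h (x : R) : option bool :=
  if x <= u then Some true else if x <= v then Some false else None.
pose cell x := (h x, x <= z).
have hN x : (h x == None) = (v < x).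
  rewrite /h ltNge; case: ifP => [xu|_]; last by case: ifP.
  by rewrite (le_trans xu uv).
have hu x : (h x == Some true) = (x <= u).
  by rewrite /h; case: ifP => //; case: ifP.
have mle y : measurable [set x : R | x <= y].
  by rewrite -set_itvNyc; exact: measurable_itv.
have mgt y : measurable [set x : R | ~~ (x <= y)].
  suff -> : [set x : R | ~~ (x <= y)] = ~` [set x : R | x <= y].
    exact: measurableC.
  by apply/seteqP; split => x /= /negP.
have mcell j : measurable [set x | cell x = j].
  have -> : [set x | cell x = j] = [set x | h x = j.1] `&` [set x | (x <= z) = j.2].
    by apply/seteqP; split => x /=; rewrite /cell; case: j => l t [/= <- <-].
  apply: measurableI.
    case: j => -[[]|] _ /=.
    - by rewrite [X in measurable X](_ : _ = [set x | x <= u]) //;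
        apply/seteqP; split => x /=; rewrite -hu => /eqP.
    - rewrite [X in measurable X](_ : _ = [set x | x <= v] `&` [set x | ~~ (x <= u)]).
        exact: measurableI.
      apply/seteqP; split => x /=; last by rewrite /h => -[-> /negbTE ->].
      by rewrite /h; case: ifP => //; case: ifP.
    - by rewrite [X in measurable X](_ : _ = [set x | ~~ (x <= v)]) //;
        apply/seteqP; split => x /=; rewrite -ltNge -hN => /eqP.
  case: j => _ [] /=; first exact: mle.
  rewrite [X in measurable X](_ : _ = [set x | ~~ (x <= z)]) //.
  by apply/seteqP; split => x /=; [move=> ->|move/negbTE].
pose Q (g : {ffun 'I_n -> option bool}) :=
  (#|[pred i | g i == Some true]| < m <= #|[pred i | g i != None]|)%N.
have QE w : Q [ffun i => h (X i w)] =
    (#|[pred i | (X i w <= u)%R]| < m <= #|[pred i | (X i w <= v)%R]|)%N.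
  rewrite /Q; congr (_ < _ <= _)%N; apply: eq_card => i; rewrite !inE ffunE ?hu //.
  by rewrite hN -leNgt.
pose Q' (f : {ffun 'I_n -> option bool * bool}) := Q [ffun i => (f i).1].
have Q'E w : Q' [ffun i => cell (X i w)] = Q [ffun i => h (X i w)].
  by congr Q; apply/ffunP => i; rewrite !ffunE.
have -> : [set w | (#|[pred i | (X i w <= u)%R]| < m <= #|[pred i | (X i w <= v)%R]|)%N] =
    [set w | Q' [ffun i => cell (X i w)]].
  by apply/seteqP; split => w /=; rewrite Q'E QE.
pose a (j : option bool * bool) := j == (None, true).
pose b (l : option bool) := l == None.
pose F (f : {ffun 'I_n -> option bool * bool}) :=
  [&& Q [ffun i => (f i).1], (s <= #|[pred i | b (f i).1]|)%N
    & (#|[pred i | a (f i)]| <= k)%N].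
have -> : [set w | [&& (#|[pred i | (X i w <= u)%R]| < m <= #|[pred i | (X i w <= v)%R]|)%N,
                  (s <= #|[pred i | (v < X i w)%R]|)%N &
                  (#|[pred i | (v < X i w <= z)%R]| <= k)%N]] =
   [set w | F [ffun i => cell (X i w)]].
  apply/seteqP; split => w /=; rewrite /F -/(Q' [ffun i => cell (X i w)]) Q'E QE;
  congr (is_true [&& _, (_ <= _)%N & (_ <= _)%N]); apply: eq_card => i;
  by rewrite !inE ffunE /a /b /cell /= ?xpair_eqE hN ?eqb_id.
rewrite (prob_cells cell mcell F) (prob_cells cell mcell Q') -EFinM lee_fin.
pose p i j := fine (P (X i @^-1` [set y | cell y = j])).
have rho01 : 0 <= expR (- (q / 2)) <= (1 : R).
  by rewrite expR_ge0 expR_le1; lra.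
have p0 i j : 0 <= p i j by exact: fine_ge0.
apply: (sum_prod_card_le p p0 fst a b Q s k _ rho01) => i l /eqP ->.
have sumE (G : option bool * bool -> R) :
    \sum_(j | j.1 == None) G j = G (None, true) + G (None, false).
  rewrite (eq_big (fun j => (j.1 == None) && true) (fun j => G (j.1, j.2))).
  - rewrite -(pair_big (pred1 None) xpredT (fun l t => G (l, t))) /=.
    by rewrite big_pred1_eq big_bool.
  - by move=> j; rewrite andbT.
  - by case.
rewrite !sumE /a /= mul1r.
have mp j : measurable (X i @^-1` [set y | cell y = j]).
  exact: measurable_preimage_pred.
have pq : q <= p i (None, true).
  have E : X i @^-1` [set y | cell y = (None, true)] =
      X i @^-1` [set x | v < x <= z].
    apply/seteqP; split => w /=; rewrite /cell -hN; first by case=> -> ->.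
    by case/andP => /eqP -> ->.
  rewrite /p -[leLHS]/(fine q%:E) fine_le //; last by rewrite E.
  by rewrite fin_num_measure.
have p1 : p i (None, true) + p i (None, false) <= 1.
  rewrite /p -fineD ?fin_num_measure // -measureU //.
    rewrite -[leRHS]/(fine 1%E) fine_le ?fin_num_measure ?probability_le1 //;
    exact: measurableU.
  by apply/seteqP; split => // w /= [->].
(* With masses a and b of the two [None] cells, a >= q and a + b <= 1 give a/2 >= (q/2)(a + b).
   Hence a/2 + b <= (1 - q/2)(a + b), and 1 - q/2 <= exp(-q/2). *)
have := p0 i (None, false); have := expR_ge1Dx (- (q / 2)); nra.
Qed.

End Independent.

(** * Order statistics and the median *)

Definition card_le {n : nat} (x : 'I_n -> R) (v : R) : nat :=
  #|[pred i | x i <= v]|.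

Lemma card_le_mono n (x : 'I_n -> R) u v : u <= v -> (card_le x u <= card_le x v)%N.
Proof.
move=> uv; apply/subset_leq_card/fintype.subsetP => i; rewrite !inE.
by move=> /le_trans; apply.
Qed.

Lemma card_gt n (x : 'I_n -> R) v : (card_le x v + #|[pred i | (v < x i)%R]|)%N = n.
Proof.
rewrite -[RHS]card_ord -(cardC [pred i | x i <= v]); congr (_ + _)%N.
by apply: eq_card => i; rewrite !inE ltNge.
Qed.

Lemma card_itv n (x : 'I_n -> R) u v : u <= v ->
  (card_le x u + #|[pred i | (u < x i <= v)%R]|)%N = card_le x v.
Proof.
move=> uv; rewrite /card_le -(cardID [pred i | x i <= u] [pred i | x i <= v]).
congr (_ + _)%N; apply: eq_card => i; rewrite !inE.
  by rewrite andbC; case: leP => //= xu; rewrite (le_trans xu uv).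
by rewrite ltNge andbC.
Qed.

Lemma count_order_stats n (x : 'I_n -> R) (a : pred R) :
  count a (order_stats x) = #|[pred i | a (x i)]|.
Proof.
rewrite /order_stats.
have /permP -> := permEl (perm_sort <=%R [seq x i | i <- enum 'I_n]).
by rewrite count_map enumT -size_filter cardE /enum_mem.
Qed.

Lemma size_order_stats n (x : 'I_n -> R) : size (order_stats x) = n.
Proof. by rewrite size_sort size_map size_enum_ord. Qed.

Section Median.
Context (m : nat) (m0 : (0 < m)%N).

Lemma med_le (x : 'I_(nodd m) -> R) v : (med x <= v) = (m <= card_le x v)%N.
Proof.
have so : sorted <=%R (order_stats x) by apply: sort_sorted; exact: le_total.
apply/idP/idP => [|mx]; last first.
  by apply: nth_count_le => //; rewrite count_order_stats prednK.
apply: contraTT; rewrite -ltnNge -ltNge => xm; apply: nth_count_gt => //.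
rewrite count_order_stats size_order_stats -ltnS prednK // xm /=; lia.
Qed.

Lemma med_lt (x : 'I_(nodd m) -> R) v :
  (med x < v) = (m <= #|[pred i | (x i < v)%R]|)%N.
Proof.
have so : sorted <=%R (order_stats x) by apply: sort_sorted; exact: le_total.
apply/idP/idP => [|mx]; last first.
  by apply: nth_count_lt => //; rewrite count_order_stats prednK.
apply: contraTT; rewrite -ltnNge -leNgt => xm; apply: nth_count_ge => //.
rewrite count_order_stats size_order_stats -ltnS prednK // xm /=; lia.
Qed.

(** Among 2m - 1 points the m-th smallest is also the m-th largest. This symmetry reduces downward
    perturbations to upward ones. *)
Lemma med_opp (x : 'I_(nodd m) -> R) : med (fun i => - x i) = - med x.
Proof.
have E v : (med (fun i => - x i) <= v) = (- med x <= v).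
  rewrite [in RHS]lerNl [in RHS]leNgt med_lt med_le /card_le -ltnNge.
  have := cardC [pred i | x i < - v]; rewrite card_ord.
  have -> : #|[predC [pred i | x i < - v]]| = #|[pred i | - x i <= v]|.
    by apply: eq_card => i; rewrite !inE -leNgt lerNl.
  set p := #|_|; set q := #|_|; move=> pq; apply/idP/idP; lia.
by apply/le_anti; rewrite E lexx -E lexx.
Qed.

Lemma dHE (n : nat) (x y : 'I_n -> R) : dH x y = #|[pred i | x i != y i]|.
Proof. by rewrite /dH; apply: eq_card => i; apply/idP/idP; rewrite ?inE. Qed.

Lemma card_le_dH (n : nat) (x y : 'I_n -> R) v :
  (card_le x v <= card_le y v + dH x y)%N.
Proof.
rewrite dHE /card_le -!sum1_card big_mkcond [in X in (X + _)%N]big_mkcond.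
rewrite [in X in (_ + X)%N]big_mkcond -big_split /=; apply: leq_sum => i _.
by rewrite !inE; case: eqVneq => [->|_]; do 2?case: ifP.
Qed.

(** Changing [k] entries removes at most [k] points from the half-line below [u], and moving points
    from there to [u + 1] attains this loss. *)
Lemma med_perturb_le (k : nat) (x : 'I_(nodd m) -> R) u :
  (forall y, (dH x y <= k)%N -> med y <= u) <-> (m + k <= card_le x u)%N.
Proof.
split=> [h|xk y xy]; last first.
  by rewrite med_le; have := card_le_dH _ x y u; lia.
rewrite leqNgt; apply/negP => xk.
(* The minimum covers the case of fewer than [k] points at or below [u]: then all of them are
   moved. *)
have /card_geqP [s [us ss sx]] : (minn k (card_le x u) <= #|[pred i | (x i <= u)%R]|)%N.
  exact: geq_minr.
pose y i := if i \in s then u + 1 else x i.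
have xy : (dH x y <= k)%N.
  apply: (@leq_trans (size s)); last by rewrite ss geq_minl.
  rewrite dHE -(card_uniqP us); apply/subset_leq_card/fintype.subsetP => i.
  by rewrite !inE /y; case: ifP => //; rewrite eqxx.
have := h y xy; rewrite med_le leqNgt => /negP; apply.
suff : (card_le y u + size s <= card_le x u)%N by rewrite ss; lia.
rewrite -(card_uniqP us) /card_le -(cardID (mem s) [pred i | (x i <= u)%R]) addnC.
apply: leq_add; apply/subset_leq_card/fintype.subsetP => i; rewrite !inE.
  by move=> si; rewrite si andbT; have := sx _ si; rewrite inE.
by rewrite /y; case: ifP => //=; rewrite gerDl ler10.
Qed.

(** The upward half of the sensitivity bound: no change of [k] entries raises the median by more
    than [t]. The downward half is the same condition for [- x]. *)
Definition spread (k : nat) (x : 'I_(nodd m) -> R) (t : R) : bool :=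
  (m + k <= card_le x (med x + t))%N.

Lemma Smed_le (eta : R) (x : 'I_(nodd m) -> R) (t : R) : 0 <= eta ->
  (Smed eta x <= t%:E)%E =
  spread (Num.truncn (eta * (nodd m)%:R)) x t &&
  spread (Num.truncn (eta * (nodd m)%:R)) (fun i => - x i) t.
Proof.
move=> eta0; set k := Num.truncn _.
(* The integer floor agrees with the natural truncation because [eta * n] is nonnegative. *)
have kE y : ((dH x y)%:Z <= kk (nodd m) eta)%R = (dH x y <= k)%N.
  by rewrite /kk floor_ge_int truncn_ge_nat ?mulr_ge0.
have NN (y : 'I_(nodd m) -> R) : (fun i => - - y i) = y.
  by apply/funext => i; rewrite opprK.
have dHN (y z : 'I_(nodd m) -> R) : dH (fun i => - y i) (fun i => - z i) = dH y z.
  by rewrite !dHE; apply: eq_card => i; rewrite !inE eqr_opp.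
apply/idP/andP => [h|[/med_perturb_le h1 /med_perturb_le h2]].
  have {}h y : (dH x y <= k)%N -> `|med x - med y| <= t.
    move=> xy; rewrite -lee_fin; apply: le_trans h.
    by apply: ereal_sup_ubound; exists y => //=; rewrite kE.
  split; apply/med_perturb_le => y xy; last first.
    have := h (fun i => - y i); rewrite -{1}(NN x) dHN => /(_ xy).
    by rewrite !med_opp ler_norml; lra.
  by have := h y xy; rewrite ler_norml; lra.
apply: ge_ereal_sup => _ [y /= + <-]; rewrite kE => xy.
rewrite lee_fin ler_norml.
have := h1 y xy; have := h2 (fun i => - y i); rewrite dHN => /(_ xy).
rewrite !med_opp; lra.
Qed.

End Median.

(** * The normal law *)

Section Normal.
Context {K : realType}.

Lemma normal_peak2 : normal_peak (1 : K) = 2 * normal_peak (2 : K).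
Proof.
rewrite /normal_peak.
have -> : (2 : K) ^+ 2 * pi *+ 2 = 2 ^+ 2 * (1 ^+ 2 * pi *+ 2) by ring.
rewrite sqrtrM ?exprn_ge0 // sqrtr_sqr ger0_norm // invfM mulrA divff ?mul1r //.
Qed.

(* Off the ball of radius 10, the density with variance 1 is dominated by a
   small multiple of the density with variance 4, whose total mass is 1. *)
Lemma normal_prob_tail (mu : K) (A : set K) : measurable A ->
  (forall x, A x -> 10 <= `|x - mu|) ->
  (normal_prob mu 1 A <= (expR (- 24))%:E)%E.
Proof.
move=> mA hA.
have mpdf s : measurable_fun setT (EFin \o normal_pdf mu s).
  by apply/measurable_EFinP; exact: measurable_normal_pdf.
have pdf0 s x : (0 <= (normal_pdf mu s x)%:E)%E by rewrite lee_fin normal_pdf_ge0.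
apply: (@le_trans _ _
  (\int[lebesgue_measure]_(x in A) ((expR (- 24))%:E * (normal_pdf mu 2 x)%:E)))%E.
  apply: ge0_le_integral => //.
  - exact: measurable_funS (mpdf 1).
  - apply: measurable_funTS; apply: emeasurable_funM => //; exact: mpdf.
  - move=> x Ax; rewrite /= -EFinM lee_fin !normal_pdfE ?oner_eq0 //.
    rewrite /normal_fun normal_peak2.
    have pk := normal_peak_ge0 (2 : K).
    rewrite -mulrA mulrCA [leRHS]mulrCA ler_wpM2l //.
    set y := x - mu.
    have y10 : 100 <= y ^+ 2.
      by rewrite -real_normK ?num_real //; have := hA x Ax; rewrite -/y; nra.
    have e2 : 2 <= expR 1 :> K by have := @expR_ge1Dx K 1; lra.
    (* The factor 2 between the peaks is absorbed into [expR 1]. It remains that y^2/2 - y^2/8 >=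
       25, which holds since 3 * 100 / 8 = 37.5. *)
    apply: (@le_trans _ _ (expR 1 * expR (- y ^+ 2 / (1 ^+ 2 *+ 2)))).
      by rewrite ler_wpM2r ?expR_ge0.
    by rewrite -!exp.expRD ler_expR; lra.
rewrite ge0_integralZl ?lee_fin ?expR_ge0 //; last exact: measurable_funS (mpdf 2).
rewrite -[leRHS]mule1 lee_pmul2l ?lte_fin ?expR_gt0 //.
rewrite -(integral_normal_pdf mu (2 : K)).
by apply: ge0_subset_integral => //; exact: mpdf.
Qed.

(** Within distance 30 of [mu] the density is at least its peak times exp(-30^2/2). The radius 30
    allows a median within 10 of [mu] and a displacement [t < 20]; the constant does not depend on
    [mu]. *)
Lemma normal_prob_itv_ge : exists2 c : K, 0 < c & forall mu u v : K,
  mu - 30 <= u -> u <= v -> v <= mu + 30 ->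
  ((c * (v - u))%:E <= normal_prob mu 1 `]u, v[%classic)%E.
Proof.
pose c : K := normal_peak 1 * expR (- 450).
have c0 : 0 < c by rewrite mulr_gt0 ?expR_gt0 ?normal_peak_gt0 ?oner_eq0.
exists c => // mu u v hu uv hv.
have mpdf : measurable_fun setT (EFin \o normal_pdf mu 1).
  by apply/measurable_EFinP; exact: measurable_normal_pdf.
apply: (@le_trans _ _ (\int[lebesgue_measure]_(x in `]u, v[%classic) cst c%:E x)%E).
  rewrite integral_cst //= lebesgue_measure_itv /= lte_fin.
  case: ltP => [_|vu]; first by rewrite EFinM.
  have -> : v - u = 0 by lra.
  by rewrite mulr0 mule0.
apply: ge0_le_integral => //.
- by move=> x _; rewrite lee_fin ltW.
- exact: measurable_funS mpdf.
- move=> x /=; rewrite in_itv /= => /andP[ux xv].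
  rewrite lee_fin normal_pdfE ?oner_eq0 // ler_wpM2l ?normal_peak_ge0 //.
  rewrite ler_expR; set y := x - mu.
  have : -30 <= y <= 30 by rewrite /y; lra.
  nra.
Qed.

End Normal.

(** * Spread around the median *)

Section SpreadGrid.
Context (m : nat) (m0 : (0 < m)%N) (mu t : R).

(** The shift by one puts [grid 0] strictly below [mu - 10], so a median equal to [mu - 10] still
    lies in a left-open cell. *)
Definition grid (l : nat) : R := mu - 10 + t / 2 * (l%:R - 1).

Lemma not_spread_grid (k N : nat) (x : 'I_(nodd m) -> R) :
  0 < t -> (3 * k <= nodd m)%N -> (6 <= nodd m)%N -> 20 <= t / 2 * (N%:R - 1) ->
  (12 * #|[pred i | (mu + 10 < x i)%R]| <= nodd m)%N ->
  (12 * #|[pred i | (x i < mu - 10)%R]| <= nodd m)%N ->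
  ~~ spread m k x t ->
  exists2 l, (l < N)%N & grid l.+2 <= mu + 30 /\
    [&& (card_le x (grid l) < m <= card_le x (grid l.+1))%N,
        (m - k <= #|[pred i | (grid l.+1 < x i)%R]|)%N &
        (#|[pred i | (grid l.+1 < x i <= grid l.+2)%R]| <= k)%N].
Proof.
move=> t0 k3 n6 N20 up dn; rewrite /spread -ltnNge; set M := med x => fail.
have Mlb : mu - 10 <= M.
  by rewrite leNgt /M med_lt //; apply/negP; lia.
have card_up := card_gt _ x (mu + 10).
have Mub : M <= mu + 10.
  have arith (a b : nat) : (a + b = nodd m -> 12 * b <= nodd m -> m <= a)%N by lia.
  by rewrite /M med_le //; exact: arith card_up up.
(* Otherwise [M + t >= mu + 10] has at least 11n/12 points below it, whereas m + k <= 5n/6 + 1/2 <=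
   11n/12 once n >= 6. *)
have t20 : t < 20.
  rewrite ltNge; apply/negP => t20.
  have mono : (card_le x (mu + 10)%R <= card_le x (M + t)%R)%N.
    by apply: card_le_mono; lra.
  have arith (a b c : nat) : (a + b = nodd m -> 12 * b <= nodd m ->
    a <= c -> c < m + k -> False)%N by lia.
  exact: arith card_up up mono fail.
have exl : exists l, M <= grid l by exists N; rewrite /grid; lra.
(* The first grid point at or above [M] is not [grid 0], so it is some [grid l.+1], and [M] lies in
   the cell [(grid l, grid l.+1]]. *)
case: (ex_minnP exl) => -[|l] Ml lmin.
  by exfalso; move: Ml; rewrite /grid; lra.
have Mgl : grid l < M by rewrite ltNge; apply/negP => /lmin; rewrite ltnn.
have g2 : grid l.+2 = grid l + t.
  by rewrite /grid -[in LHS]addn2 natrD; lra.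
have g1 : grid l.+1 = grid l + t / 2.
  by rewrite /grid -[in LHS]addn1 natrD; lra.
exists l.
  rewrite ltnNge; apply/negP => Nl.
  have /lmin : M <= grid N by rewrite /grid; lra.
  lia.
split; first lra.
(* Two cells have total length [t], so [grid l.+2 < M + t] and fewer than m + k points lie up to
   [grid l.+2]. Both remaining counts follow from this. *)
have c2 : (card_le x (grid l.+2) <= card_le x (M + t)%R)%N by apply: card_le_mono; lra.
have i2 := card_itv _ x (grid l.+1) (grid l.+2) ltac:(lra).
have i1 := card_gt _ x (grid l.+1).
have m1 : (m <= card_le x (grid l.+1))%N by rewrite -med_le.
have m2 : (card_le x (grid l) < m)%N by rewrite ltnNge -med_le // -ltNge.
apply/and3P; split; first by rewrite m2.
- have arith (a b c g : nat) : (a + b = nodd m -> a + c = g ->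
    g < m + k -> m - k <= b)%N by lia.
  exact: arith i1 i2 (leq_ltn_trans c2 fail).
- have arith (a c g : nat) : (a + c = g -> g < m + k -> m <= a -> c <= k)%N by lia.
  exact: arith i2 (leq_ltn_trans c2 fail) m1.
Qed.

End SpreadGrid.

(** * Measurability of counts, median and spread *)

Section Measurability.
Context {d : measure_display} {T : measurableType d}.

Lemma measurable_set_le (f g : T -> R) :
  measurable_fun setT f -> measurable_fun setT g ->
  measurable [set w | f w <= g w].
Proof.
move=> mf mg; rewrite -[[set w | _]]setTI.
exact: (measurable_fun_ler mf mg measurableT (Y := [set true])).
Qed.

Lemma measurable_set_lt (f g : T -> R) :
  measurable_fun setT f -> measurable_fun setT g ->
  measurable [set w | f w < g w].
Proof.
move=> mf mg; rewrite -[[set w | _]]setTI.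
exact: (measurable_fun_ltr mf mg measurableT (Y := [set true])).
Qed.

(** A count is a function of a finite boolean vector, whose fibers are finite intersections of
    measurable sets. *)
Lemma measurable_card {I : finType} (b : I -> T -> bool) (G : pred nat) :
  (forall i, measurable [set w | b i w]) ->
  measurable [set w | G #|[pred i | b i w]|].
Proof.
move=> mb.
have mb' i j : measurable [set w | b i w = j].
  case: j; first exact: mb.
  rewrite [X in measurable X](_ : _ = ~` [set w | b i w]); first exact: measurableC.
  by apply/seteqP; split => w /= => [->|/negP/negbTE].
pose F (g : {ffun I -> bool}) := G #|[pred i | g i]|.
rewrite [X in measurable X](_ : _ = [set w | F [ffun i => b i w]]).
  exact: (measurable_ffun_pred b mb' F).
by apply/seteqP; split => w /=; congr (is_true (G _)); apply: eq_card => i;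
  rewrite !inE ffunE.
Qed.

Context (m : nat) (m0 : (0 < m)%N) (X : 'I_(nodd m) -> T -> R).
Hypothesis mX : forall i, measurable_fun setT (X i).

Lemma measurable_med : measurable_fun setT (fun w => med (fun i => X i w)).
Proof.
apply: (measurability _ (RGenInftyO.measurableE R)) => _ [_ [v ->] <-].
rewrite setTI [X in measurable X](_ : _ =
    [set w | (m <= #|[pred i | (X i w < v)%R]|)%N]).
  apply: (measurable_card (fun i w => X i w < v) (fun c => (m <= c)%N)) => i.
  exact: (measurable_set_lt (X i) (cst v)).
by apply/seteqP; split => w /=; rewrite in_itv /= med_lt.
Qed.

Lemma measurable_spread (k : nat) (t : R) :
  measurable [set w | spread m k (fun i => X i w) t].
Proof.
apply: (measurable_card (fun i w => X i w <= med (fun i => X i w) + t)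
  (fun c => (m + k <= c)%N)) => i.
apply: (measurable_set_le (X i) (fun w => med (fun i => X i w) + t)) => //.
by apply: measurable_funD => //; exact: measurable_med.
Qed.

End Measurability.

(** * Probability of a large spread *)

Section SpreadProbability.
Context {d : measure_display} {T : measurableType d} (P : probability T R).

(** Chernoff with weight exp(24) gives exp(24 r) P <= 2^n <= exp(n), and 24 r >= 2n. *)
Lemma prob_card_ge_small (n r : nat) (X : 'I_n -> T -> R) (a : R -> bool) :
  (forall i, measurable_fun setT (X i)) ->
  (forall B : 'I_n -> set R, (forall i, measurable (B i)) ->
    P (\bigcap_i (X i @^-1` B i)) = (\prod_(i < n) P (X i @^-1` B i))%E) ->
  measurable [set y | a y] -> (n <= 12 * r)%N ->
  (forall i, (P (X i @^-1` [set y | a y]) <= (expR (- 24))%:E)%E) ->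
  (P [set w | (r <= #|[pred i | a (X i w)]|)%N] <= (expR (- n%:R))%:E)%E.
Proof.
move=> mX indX ma nr ha.
have e1 : 1 <= expR 24 :> R by have := @expR_ge1Dx R 24; lra.
have := prob_card_ge P X mX indX a r (expR (- 24)) (expR 24) ma e1 ha.
rewrite -exp.expRD addNr exp.expR0 -[_ ^+ r]expRM_natl => h.
have mS : measurable [set w | (r <= #|[pred i | a (X i w)]|)%N].
  apply: (measurable_card (fun i w => a (X i w)) (fun c => (r <= c)%N)) => i.
  exact: (measurable_preimage_pred _ mX i [set y | a y] ma).
rewrite -(fineK (fin_num_measure P _ mS)) in h *.
move: h; rewrite -EFinM !lee_fin => h.
have e2 : 1 + 1 <= expR 1 :> R by have := @expR_ge1Dx R 1; lra.
rewrite -(ler_pM2l (expR_gt0 (r%:R * 24))) -exp.expRD.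
apply: (le_trans h); apply: (@le_trans _ _ (expR (n%:R * 1))).
  by rewrite expRM_natl lerXn2r ?nnegrE ?expR_ge0.
rewrite ler_expR; have : (n%:R : R) <= (12 * r)%:R by rewrite ler_nat.
by rewrite natrM; lra.
Qed.

Context (m : nat) (m0 : (0 < m)%N) (X : 'I_(nodd m) -> T -> R).
Hypothesis mX : forall i, measurable_fun setT (X i).
Hypothesis indX : forall B : 'I_(nodd m) -> set R, (forall i, measurable (B i)) ->
  P (\bigcap_i (X i @^-1` B i)) = (\prod_(i < nodd m) P (X i @^-1` B i))%E.
Context (mu c0 : R) (c0_gt0 : 0 < c0).
Hypothesis Xitv : forall i u v, mu - 30 <= u -> u <= v -> v <= mu + 30 ->
  ((c0 * (v - u)%R)%:E <= P (X i @^-1` [set x | (u < x <= v)%R]))%E.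
Hypothesis Xup : forall i,
  (P (X i @^-1` [set x | (mu + 10 < x)%R]) <= (expR (- 24))%:E)%E.
Hypothesis Xdown : forall i,
  (P (X i @^-1` [set x | (x < mu - 10)%R]) <= (expR (- 24))%:E)%E.

Let cle w v := card_le (fun i => X i w) v.

Let meas_cle v (G : pred nat) : measurable [set w | G (cle w v)].
Proof.
apply: (measurable_card (fun i w => X i w <= v)) => i.
exact: (measurable_set_le (X i) (cst v)).
Qed.

(** The law enters only through the mass of intervals near [mu] and the two tails, so the bound
    serves both [X] and [- X]. The first term comes from the disjoint median cells, the two others
    from too many points beyond [mu + 10] or [mu - 10]. *)
Lemma prob_not_spread (k : nat) (t : R) :
  0 < t -> (3 * k <= nodd m)%N -> (6 <= nodd m)%N ->
  (P [set w | ~~ spread m k (fun i => X i w) t] <=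
   (2 ^+ k * expR (- (c0 * t * (nodd m)%:R / 24)) +
    (expR (- (nodd m)%:R) + expR (- (nodd m)%:R)))%:E)%E.
Proof.
move=> t0 k3 n6.
(* The least integer above n/12: both [n <= 12 * r] and the integer form of the negated tail event
   hold. *)
pose r := (nodd m %/ 12).+1.
have nr : (nodd m <= 12 * r)%N by rewrite /r; lia.
have lt_r c : ~~ (r <= c)%N -> (12 * c <= nodd m)%N by rewrite /r; lia.
(* The cells must reach [mu + 10], that is N - 1 >= 40/t; the extra unit pays for the shift in
   [grid]. *)
pose N := (Num.truncn (40 / t)).+2.
have N20 : 20 <= t / 2 * (N%:R - 1).
  have : 40 / t < (Num.truncn (40 / t)).+1%:R.
    by have /andP[] := truncn_itv (divr_ge0 (ler0n R 40) (ltW t0)).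
  rewrite ltr_pdivrMr // /N -[in X in _ -> X]addn1 natrD; lra.
pose g := grid mu t.
have g1 l : g l.+1 = g l + t / 2.
  by rewrite /g /grid -[in LHS]addn1 natrD; lra.
have g_mono : {homo g : l l' / (l <= l')%N >-> l <= l'}.
  by move=> l l' ll; rewrite /g /grid lerD2l ler_wpM2l ?lerB ?ler_nat //; lra.
pose E l := [set w | (cle w (g l) < m <= cle w (g l.+1))%N].
have mE l : measurable (E l).
  rewrite (_ : E l = [set w | (cle w (g l) < m)%N] `&` [set w | (m <= cle w (g l.+1))%N]).
    apply: measurableI; first exact: (meas_cle _ (fun c => c < m)%N).
    exact: (meas_cle _ (fun c => m <= c)%N).
  by apply/seteqP; split => w /= /andP.
have tE : trivIset setT E.
  apply/trivIsetP => i j _ _ ij; apply/seteqP; split => // w /=.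
  wlog ltij : i j {ij} / (i < j)%N.
    by move=> H; case: (ltngtP i j) ij => // h _ [? ?]; [apply: (H i j)|apply: (H j i)].
  move=> [/andP[_ mi] /andP[jm _]].
  have := card_le_mono _ (fun i => X i w) _ _ (g_mono _ _ ltij).
  rewrite -/(cle w _) -/(cle w _); lia.
(* Including the deterministic condition makes [S l] empty for cells too far out, where no lower
   bound on the mass is available. *)
pose S l := [set w | (g l.+2 <= mu + 30) &&
  [&& (cle w (g l) < m <= cle w (g l.+1))%N,
      (m - k <= #|[pred i | (g l.+1 < X i w)%R]|)%N &
      (#|[pred i | (g l.+1 < X i w <= g l.+2)%R]| <= k)%N]].
have mS l : measurable (S l).
  rewrite (_ : S l = [set w | g l.+2 <= mu + 30] `&` (E l `&`
    ([set w | (m - k <= #|[pred i | (g l.+1 < X i w)%R]|)%N] `&`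
     [set w | (#|[pred i | (g l.+1 < X i w <= g l.+2)%R]| <= k)%N]))).
    apply: measurableI.
      exact: (measurable_set_le (cst (g l.+2)) (cst (mu + 30))).
    apply: measurableI => //; apply: measurableI.
      apply: (measurable_card (fun i w => g l.+1 < X i w) (fun c => m - k <= c)%N) => i.
      exact: (measurable_set_lt (cst _) (X i)).
    apply: (measurable_card (fun i w => g l.+1 < X i w <= g l.+2) (fun c => c <= k)%N) => i.
    rewrite (_ : [set w | _] = [set w | g l.+1 < X i w] `&` [set w | X i w <= g l.+2]).
      apply: measurableI; first exact: (measurable_set_lt (cst _) (X i)).
      exact: (measurable_set_le (X i) (cst _)).
    by apply/seteqP; split => w /= /andP.
  apply/seteqP; split => w /=; first by case/and4P.
  by move=> [? [? [? ?]]]; apply/and4P; split.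
pose q := c0 * (t / 2).
have q0 : 0 <= q by rewrite /q mulr_ge0 ?ltW ?divr_gt0.
pose K : R := 2 ^+ k * expR (- (q / 2)) ^+ (m - k).
have K0 : 0 <= K by rewrite mulr_ge0 ?exprn_ge0 ?expR_ge0.
have PS l : (P (S l) <= K%:E * P (E l))%E.
  have [gl|gl] := boolP (g l.+2 <= mu + 30); last first.
    rewrite (_ : S l = set0) ?measure0 ?mule_ge0 ?lee_fin //.
    by apply/seteqP; split => // w /andP[gl' _]; case/negP: gl.
  rewrite (_ : S l = [set w | [&& (cle w (g l) < m <= cle w (g l.+1))%N,
      (m - k <= #|[pred i | (g l.+1 < X i w)%R]|)%N &
      (#|[pred i | (g l.+1 < X i w <= g l.+2)%R]| <= k)%N]]).
    apply: (prob_card_itv_le P X mX indX (g l) (g l.+1) (g l.+2) q m (m - k) k) => //.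
      by rewrite g1 lerDl divr_ge0 ?ltW.
    move=> i; have := Xitv i (g l.+1) (g l.+2).
    rewrite [in X in _ -> _ -> _ -> X](_ : c0 * (g l.+2 - g l.+1) = q).
      apply => //; last by rewrite (g1 l.+1) lerDl divr_ge0 ?ltW.
      by have := g_mono 1%N l.+1 isT; rewrite /g /grid; lra.
    by rewrite /q (g1 l.+1); ring.
  by apply/seteqP; split => w; [case/andP|move=> h; apply/andP].
have PbigS : (P (\big[setU/set0]_(l < N) S l) <= K%:E)%E.
  apply: (le_trans (Boole_inequality P (fun i _ => mS i))).
  apply: (@le_trans _ _ (\sum_(l < N) K%:E * P (E l))%E).
    by apply: lee_sum => l _; exact: PS.
  rewrite -ge0_sume_distrr; last by move=> l _; exact: measure_ge0.
  rewrite -measure_bigsetU //.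
  rewrite -[leRHS]mule1 lee_wpmul2l ?lee_fin // probability_le1 //.
  exact: bigsetU_measurable.
pose U := [set w | (r <= #|[pred i | (mu + 10 < X i w)%R]|)%N].
pose D := [set w | (r <= #|[pred i | (X i w < mu - 10)%R]|)%N].
have mU : measurable U.
  apply: (measurable_card (fun i w => mu + 10 < X i w) (fun c => r <= c)%N) => i.
  exact: (measurable_set_lt (cst _) (X i)).
have mD : measurable D.
  apply: (measurable_card (fun i w => X i w < mu - 10) (fun c => r <= c)%N) => i.
  exact: (measurable_set_lt (X i) (cst _)).
have PU : (P U <= (expR (- (nodd m)%:R))%:E)%E.
  apply: (prob_card_ge_small _ r X (fun y => mu + 10 < y)) => //.
  exact: (measurable_set_lt (cst _) id).
have PD : (P D <= (expR (- (nodd m)%:R))%:E)%E.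
  apply: (prob_card_ge_small _ r X (fun y => y < mu - 10)) => //.
  exact: (measurable_set_lt id (cst _)).
have mbig : measurable (\big[setU/set0]_(l < N) S l) by exact: bigsetU_measurable.
apply: (@le_trans _ _ (P (\big[setU/set0]_(l < N) S l `|` (U `|` D)))).
  apply: le_measure; rewrite ?inE.
  - rewrite (_ : [set w | _] = ~` [set w | spread m k (fun i => X i w) t]).
      by apply: measurableC; exact: measurable_spread.
    by apply/seteqP; split => w /= /negP.
  - by apply: measurableU => //; exact: measurableU.
  - move=> w /= fail.
    have [Uw|nU] := boolP (r <= #|[pred i | (mu + 10 < X i w)%R]|)%N; first by right; left.
    have [Dw|nD] := boolP (r <= #|[pred i | (X i w < mu - 10)%R]|)%N; first by right; right.
    left; have [l lN [gl Sl]] := not_spread_grid m m0 mu t k N (fun i => X i w)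
      t0 k3 n6 N20 (lt_r _ nU) (lt_r _ nD) fail.
    rewrite -bigcup_mkord; exists l => //=.
    by apply/andP.
apply: (le_trans (measureU2 P mbig (measurableU _ _ mU mD))).
rewrite !EFinD; apply: leeD; last first.
  by apply: (le_trans (measureU2 P mU mD)); exact: leeD.
apply: (le_trans PbigS); rewrite lee_fin ler_wpM2l ?exprn_ge0 // -expRM_natl ler_expR.
(* Since 3k <= n and 2m = n + 1, 6(m - k) >= n + 3. The exponent q(m - k)/2 = c0 t (m - k)/4 is
   therefore at least c0 t n / 24. *)
have : ((nodd m)%:R : R) <= (6 * (m - k))%:R by rewrite ler_nat; lia.
rewrite natrM mulrN lerN2 /q => h.
have -> : (m - k)%:R * (c0 * (t / 2) / 2) = c0 * t * (6 * (m - k)%:R) / 24 by field.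
by rewrite ler_wpM2r ?invr_ge0 // ler_wpM2l // mulr_ge0 ?ltW.
Qed.

End SpreadProbability.

(** * Choice of the constants *)

(** With L = log(1/beta), the choice C >= 48/c0 makes the exponent at least 2(eta n + L). One eta n
    pays for 2^k <= exp(eta n), and exp(-2L) is beta^2. *)
Lemma chernoff_budget (K : realType) (c0 C eta beta n : K) (k : nat) :
  0 < c0 -> 48 / c0 <= C -> 0 <= eta -> 0 < n -> 0 < beta < 2^-1 -> k%:R <= eta * n ->
  2 ^+ k * expR (- (c0 * (C * (eta + ln beta^-1 / n)) * n / 24)) <= beta ^+ 2.
Proof.
move=> c0_gt0 hC eta0 n0 /andP[b0 b2] kn; set L := ln beta^-1.
have bL : expR (- L) = beta by rewrite /L lnV ?posrE // opprK lnK ?posrE.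
have L0 : 0 <= L by rewrite /L ln_ge0 // invf_ge1 //; lra.
have e2 : 2 <= expR 1 :> K by have := @expR_ge1Dx K 1; lra.
apply: (@le_trans _ _ (expR (k%:R * 1) *
    expR (- (c0 * (C * (eta + L / n)) * n / 24)))).
  by rewrite ler_wpM2r ?expR_ge0 // expRM_natl lerXn2r ?nnegrE ?expR_ge0.
rewrite -bL -expRM_natl -exp.expRD ler_expR.
have -> : c0 * (C * (eta + L / n)) * n = c0 * C * (eta * n + L).
  by field; rewrite gt_eqF.
have dC : 48 <= c0 * C by rewrite mulrC -ler_pdivrMr.
have en : 0 <= eta * n by rewrite mulr_ge0 // ltW.
have : 48 * (eta * n + L) <= c0 * C * (eta * n + L).
  by rewrite ler_wpM2r // addr_ge0.
lra.
Qed.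

(** For n <= 5 this makes the claimed lower bound on the probability nonpositive. *)
Lemma small_sample_bound (K : realType) (C n : K) :
  expR 6 <= C -> n <= 5 -> 1 <= C * expR (- n).
Proof.
move=> hC n5; apply: (@le_trans _ _ (expR 6 * expR (- n))).
  by rewrite -exp.expRD; have := @expR_ge1Dx K (6 - n); lra.
by rewrite ler_wpM2r ?expR_ge0.
Qed.

(** The two one-sided failures cost 2x + 4e in all: 2 beta^2 <= beta as beta < 1/2, and 4 <= 1 + 6
    <= exp(6) <= C. *)
Lemma failure_budget (K : realType) (C beta e x : K) :
  expR 6 <= C -> 0 < beta < 2^-1 -> 0 <= e -> x <= beta ^+ 2 ->
  1 - beta - C * e <= 1 - (x + (e + e) + (x + (e + e))).
Proof.
move=> hC hb e0 hx; have := @expR_ge1Dx K 6; have := @expR_ge0 K 6.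
have : 2 * beta ^+ 2 <= beta by nra.
have : expR 6 * e <= C * e by rewrite ler_wpM2r.
have : (1 + 6) * e <= expR 6 * e by rewrite ler_wpM2r ?expR_ge1Dx.
lra.
Qed.

(** * The two-sided bound for a normal sample *)

Section NormalSample.
Context {d : measure_display} {T : measurableType d} (P : probability T R).
Context (m : nat) (m0 : (0 < m)%N) (X : 'I_(nodd m) -> {RV P >-> R}).
Context (mu c0 : R) (c0_gt0 : 0 < c0).
Hypothesis normal_itv : forall u v, mu - 30 <= u -> u <= v -> v <= mu + 30 ->
  ((c0 * (v - u))%:E <= normal_prob mu 1 `]u, v[%classic)%E.
Hypothesis indX : mutually_independent X.
Hypothesis lawX : forall i, has_normal_law (X i) mu 1.

Let mX i : measurable_fun setT (X i).
Proof. exact: measurable_funPT. Qed.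

Let PX i A : measurable A -> P (X i @^-1` A) = normal_prob mu 1 A.
Proof. by move=> mA; rewrite -(lawX i A mA). Qed.

Let mXA i A : measurable A -> measurable (X i @^-1` A).
Proof. by move=> mA; rewrite -[_ @^-1` _]setTI; exact: mX. Qed.

(** Allowing any [A] that contains the open interval covers both kinds of half-open interval;
    reflection turns []u, v]] into [[- v, - u[]. *)
Let PX_itv i (u v : R) (A : set R) : measurable A -> `]u, v[%classic `<=` A ->
  mu - 30 <= u -> u <= v -> v <= mu + 30 ->
  ((c0 * (v - u))%:E <= P (X i @^-1` A))%E.
Proof.
move=> mA sA hu uv hv; apply: (le_trans (normal_itv u v hu uv hv)).
rewrite -(PX i); last exact: measurable_itv.
apply: le_measure; rewrite ?inE; [|exact: mXA|by move=> w /= /sA].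
by apply: mXA; exact: measurable_itv.
Qed.

Let mlt (a : R) : measurable [set x : R | x < a].
Proof. exact: (measurable_set_lt id (cst a)). Qed.

Let mgt (a : R) : measurable [set x : R | a < x].
Proof. exact: (measurable_set_lt (cst a) id). Qed.

Let PX_up i : (P (X i @^-1` [set x | (mu + 10 < x)%R]) <= (expR (- 24))%:E)%E.
Proof.
rewrite PX; last exact: mgt.
apply: (normal_prob_tail _ _ (mgt _)) => x /= hx.
by rewrite ler_normr; apply/orP; left; lra.
Qed.

Let PX_down i : (P (X i @^-1` [set x | (x < mu - 10)%R]) <= (expR (- 24))%:E)%E.
Proof.
rewrite PX; last exact: mlt.
apply: (normal_prob_tail _ _ (mlt _)) => x /= hx.
by rewrite ler_normr; apply/orP; right; lra.
Qed.

Let spread_bound (k : nat) (t : R) : R :=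
  2 ^+ k * expR (- (c0 * t * (nodd m)%:R / 24)) +
    (expR (- (nodd m)%:R) + expR (- (nodd m)%:R)).

Lemma prob_not_spread_normal (k : nat) (t : R) :
  0 < t -> (3 * k <= nodd m)%N -> (6 <= nodd m)%N ->
  (P [set w | ~~ spread m k (fun i => X i w) t] <= (spread_bound k t)%:E)%E.
Proof.
apply: (prob_not_spread P m m0 X mX indX mu c0 c0_gt0) => //.
move=> i u v; apply: PX_itv => [|x /=]; last first.
  by rewrite in_itv /= => /andP[-> /ltW].
rewrite (_ : [set x | _] = `]u, v]%classic); first exact: measurable_itv.
by apply/seteqP; split => x /=; rewrite in_itv.
Qed.

(** The reflected sample satisfies the same hypotheses around [- mu], with the two tails
    exchanged. *)
Lemma prob_not_spread_normal_opp (k : nat) (t : R) :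
  0 < t -> (3 * k <= nodd m)%N -> (6 <= nodd m)%N ->
  (P [set w | ~~ spread m k (fun i => (- X i w)%R) t] <= (spread_bound k t)%:E)%E.
Proof.
have mN (A : set R) : measurable A -> measurable (-%R @^-1` A).
  by move=> mA; rewrite -[_ @^-1` _]setTI; exact: oppr_measurable.
apply: (prob_not_spread P m m0 (fun i w => - X i w) _ _ (- mu) c0 c0_gt0).
- by move=> i; exact: measurable_funN.
- by move=> B mB; exact: (indX (fun i => -%R @^-1` B i) (fun i => mN _ (mB i))).
- move=> i u v hu uv hv.
  have -> : v - u = - u - - v by lra.
  rewrite (_ : _ @^-1` _ = X i @^-1` [set x | - v <= x < - u]).
    apply: PX_itv; try lra.
      rewrite (_ : [set x | _] = `[- v, - u[%classic); first exact: measurable_itv.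
      by apply/seteqP; split => x /=; rewrite in_itv.
    by move=> x /=; rewrite in_itv /= => /andP[/ltW -> ->].
  by apply/seteqP; split => w /= h; lra.
- move=> i; rewrite (_ : _ @^-1` _ = X i @^-1` [set x | x < mu - 10]) //.
  by apply/seteqP; split => w /= h; lra.
- move=> i; rewrite (_ : _ @^-1` _ = X i @^-1` [set x | mu + 10 < x]) //.
  by apply/seteqP; split => w /= h; lra.
Qed.

Lemma prob_Smed_ge (eta t : R) :
  0 < eta < 3^-1 -> 0 < t -> (6 <= nodd m)%N ->
  ((1 - (spread_bound (Num.truncn (eta * (nodd m)%:R)) t +
         spread_bound (Num.truncn (eta * (nodd m)%:R)) t))%:E <=
   P [set w | (Smed eta (fun i => X i w) <= t%:E)%E])%E.
Proof.
move=> /andP[eta0 eta3] t0 n6; set k := Num.truncn _.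
have k3 : (3 * k <= nodd m)%N.
  rewrite -(ler_nat R) natrM.
  have : k%:R <= eta * (nodd m)%:R by rewrite truncn_le mulr_ge0 ?(ltW eta0).
  have : eta * (nodd m)%:R <= 3^-1 * (nodd m)%:R by rewrite ler_wpM2r ?ler0n ?ltW.
  lra.
pose F1 := [set w | ~~ spread m k (fun i => X i w) t].
pose F2 := [set w | ~~ spread m k (fun i => - X i w) t].
have mC (Y : T -> bool) : measurable [set w | Y w] -> measurable [set w | ~~ Y w].
  move=> mY; rewrite (_ : [set w | ~~ _] = ~` [set w | Y w]).
    exact: measurableC.
  by apply/seteqP; split => w /= /negP.
have mF1 : measurable F1.
  by apply: mC; exact: (measurable_spread m m0 (fun i => X i)).
have mF2 : measurable F2.
  apply: mC; apply: (measurable_spread m m0 (fun i w => - X i w)) => i.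
  exact: measurable_funN.
rewrite (_ : [set w | (Smed _ _ <= _)%E] = ~` (F1 `|` F2)); last first.
  apply/seteqP; split => w /=; rewrite (Smed_le m m0 eta) ?(ltW eta0) // -/k.
    by case/andP => h1 h2 [|] /negP.
  by move=> h; apply/andP; split; apply/negP => /negP hn; apply: h; [left|right].
rewrite probability_setC; last exact: measurableU.
rewrite EFinB leeB // EFinD.
apply: (le_trans (measureU2 P mF1 mF2)); apply: leeD.
  exact: prob_not_spread_normal.
exact: prob_not_spread_normal_opp.
Qed.

Lemma prob_Smed_ge_beta (C eta beta : R) :
  48 / c0 <= C -> expR 6 <= C -> 0 < eta < 3^-1 -> 0 < beta < 2^-1 ->
  ((1 - beta - C * expR (- (nodd m)%:R))%:E <=
   P [set w | (Smed eta (fun i => X i w) <=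
               (C * (eta + ln (beta^-1) / (nodd m)%:R))%:E)%E])%E.
Proof.
move=> C48 C6 eta3 beta2.
have [n6|n5] := leqP 6 (nodd m); last first.
  apply: (@le_trans _ _ 0%E) => //; rewrite lee_fin.
  rewrite subr_le0; apply: (@le_trans _ _ 1).
    by rewrite gerBl; case/andP: beta2 => /ltW.
  by apply: small_sample_bound; rewrite ?(ler_nat _ _ 5).
have n0 : 0 < (nodd m)%:R :> R by rewrite ltr0n; lia.
have C0 : 0 < C by apply: lt_le_trans C6; exact: expR_gt0.
have L0 : 0 <= ln beta^-1.
  case/andP: beta2 => b0 b2; rewrite ln_ge0 // invf_ge1 //.
  by apply/ltW/(lt_trans b2); rewrite invf_lt1 // ltr1n.
have [eta0 _] := andP eta3.
have t0 : 0 < C * (eta + ln beta^-1 / (nodd m)%:R).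
  by rewrite mulr_gt0 // ltr_wpDr // divr_ge0 // ltW.
apply: le_trans (prob_Smed_ge eta _ eta3 t0 n6).
rewrite lee_fin; apply: failure_budget => //.
apply: chernoff_budget => //; first exact: ltW.
by rewrite truncn_le mulr_ge0 // ltW.
Qed.

End NormalSample.

Theorem theoremB3 :
  exists c C : R, 0 < c /\ 0 < C /\
  forall (m : nat), (0 < m)%N ->
  forall (mu : R) (d : measure_display) (T : measurableType d) (P : probability T R)
         (X : 'I_(nodd m) -> {RV P >-> R}),
    mutually_independent X ->
    (forall i, has_normal_law (X i) mu 1) ->
  forall eta : R, 0 < eta < 3^-1 ->
  forall beta : R, 0 < beta < 2^-1 ->
    ((1 - beta - C * expR (- (c * (nodd m)%:R)))%:E <=
      P [set w | (Smed eta (fun i => X i w) <=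
                  (C * (eta + ln (beta^-1) / (nodd m)%:R))%:E)%E])%E.
Proof.
have [c0 c0_gt0 normal_itv] := @normal_prob_itv_ge R.
(* The rate 1 is that of the tail terms exp(-n). The sum dominates both lower bounds required of
   [C]: 48/c0 for the cells and exp(6) for the tails and small samples. *)
exists 1, (48 / c0 + expR 6); split; first exact: ltr01.
split; first by rewrite addr_gt0 ?expR_gt0 ?divr_gt0.
move=> m m0 mu d T P X indX lawX eta eta3 beta beta2; rewrite mul1r.
apply: (prob_Smed_ge_beta P m m0 X mu c0 c0_gt0 (normal_itv mu) indX lawX) => //.
  by rewrite lerDl expR_ge0.
by rewrite lerDr divr_ge0 // ltW.
Qed.
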